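(* The quadratic form $t^2+2x^2+5y^2+10z^2$ is universal: for every positive integer $n$ there exist $t,x,y,z\in\mathbb{Z}$ such that $t^2+2x^2+5y^2+10z^2=n$.
   Context: A quaternary integral quadratic form is said to represent $n$ if it takes the value $n$ at some point of $\mathbb{Z}^4$; it is universal if it represents every positive integer. *)

(* Defs.v *)
From Stdlib Require Import ZArith.

Open Scope Z_scope.

(* A quaternary integral form is given by its values on Z^4. *)
Definition represents (f : Z -> Z -> Z -> Z -> Z) (n : Z) : Prop :=
  exists t x y z : Z, f t x y z = n.

Definition universal (f : Z -> Z -> Z -> Z -> Z) : Prop :=
  forall n : Z, 0 < n -> represents f n.

(* Main.v *)
Require Import Defs.
From Stdlib Require Import ZArith List Znumtheory Lia Classical.
Open Scope Z_scope.

(** The form is the norm form of the quaternion order spanned by 1, i, j, k with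
    i^2 = -2, j^2 = -5, k = ij, so the represented integers are closed under
    multiplication [represented_mul] and it is enough to represent every prime p.

    If -2, -10, or both -1 and -5 are squares modulo an odd p, Thue's lemma gives a
    small multiple of p as a value of x^2 + 2y^2, x^2 + 10y^2 or x^2 + 5y^2, and the
    small factor is removed by congruences.  Multiplicativity of the quadratic
    character shows that otherwise, apart from p = 3 and p = 5, the numbers 2 and 5
    are squares modulo p and -1 is not.

    In that case p is represented by the ternary subform t^2 + 5y^2 + 10z^2.
    Suppose A > 0 is a nonresidue modulo p with AC = B^2 + 2p.  Then -5A is a square
    modulo p, so on a suitable sublattice of index p of Z^3 the form
    5x^2 + Ay^2 + 2Byz + Cz^2 is divisible by p; divided by p it is a positive ternary
    form of determinant 10 with the value 5p.  Reduction theory and congruences modulo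
    2 and 5 leave only the class of x^2 + 2y^2 + 5z^2 [ternary_det_10].  From
    5p = x^2 + 2y^2 + 5z^2 follow 5 | x and 5 | y, hence p = z^2 + 5x'^2 + 10y'^2.

    It remains to find A [exists_nonresidue_divisor].  Dirichlet's theorem would give
    one; a genus argument in the class group of Z[sqrt(-2p)] is used instead.  Say
    that all A > 0 dividing some B^2 + 2p were residues.  By Legendre's method
    [legendre] the norm form of every ideal class would then represent a square, which
    makes every class a square [ideal_square_root].  The class of the prime above 2 is
    not principal but has principal square.  Starting from it and extracting square
    roots again and again produces classes of order 2, 4, 8 and so on, which are
    pairwise distinct; but there are only finitely many classes
    [same_class_ideal_reduced]. *)

(** * Quadratic residues, pigeonhole and Thue's lemma *)

Definition residue (p a : Z) : Prop := exists x, (p | x * x - a).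

Definition below (n : Z) : list Z := map Z.of_nat (seq 0 (Z.to_nat n)).

Lemma in_below n x : In x (below n) <-> 0 <= x < n.
Proof.
unfold below; rewrite in_map_iff; split.
- intros (k & <- & Hk); apply in_seq in Hk; lia.
- intro H; exists (Z.to_nat x); rewrite in_seq; lia.
Qed.

Lemma length_below n : 0 <= n -> Z.of_nat (length (below n)) = n.
Proof. intro; unfold below; rewrite length_map, length_seq; lia. Qed.

Lemma NoDup_below n : NoDup (below n).
Proof.
apply NoDup_map_NoDup_ForallPairs, seq_NoDup.
intros x y _ _; apply Nat2Z.inj.
Qed.

Lemma NoDup_pairs {A B : Type} (l : list A) (l' : list B) :
  NoDup l -> NoDup l' -> NoDup (list_prod l l').
Proof.
intros Hl Hl'; induction Hl as [|a l Ha Hl IH]; [constructor|].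
cbn; apply NoDup_app; [|exact IH|].
- apply NoDup_map_NoDup_ForallPairs; [|exact Hl'].
  intros x y _ _; congruence.
- intros x Hx Hx'; apply in_map_iff in Hx; destruct Hx as (y & <- & _).
  apply in_prod_iff in Hx'; tauto.
Qed.

(** The boxes are given by a relation rather than a function, so that a box can be
    a representative whose existence alone is known. *)
Lemma pigeonhole_rel {A B : Type} (R : A -> B -> Prop) (l : list A) :
  NoDup l -> forall l' : list B, (forall x, In x l -> exists c, In c l' /\ R x c) ->
  (length l' < length l)%nat ->
  exists x y c, In x l /\ In y l /\ x <> y /\ R x c /\ R y c.
Proof.
intro Hl; induction Hl as [|a l Ha Hl IH]; intros l' HR Hlen; [cbn in Hlen; lia|].
destruct (HR a) as (c & Hc & Rac); [now left|].
destruct (classic (exists y, In y l /\ R y c)) as [(y & Hy & Ryc)|N].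
{ exists a, y, c; repeat split; try assumption; [now left|now right|].
  intros ->; contradiction. }
apply in_split in Hc; destruct Hc as (l1 & l2 & ->).
rewrite length_app in Hlen; cbn in Hlen.
destruct (IH (l1 ++ l2)) as (x & y & d & Hx & Hy & H).
- intros x Hx. destruct (HR x) as (d & Hd & Rxd); [now right|].
  exists d; split; [|exact Rxd].
  apply in_elt_inv in Hd. destruct Hd as [<-|Hd]; [|exact Hd].
  exfalso; apply N; exists x; auto.
- rewrite length_app; lia.
- exists x, y, d; repeat split; try tauto; now right.
Qed.

Lemma pigeonhole {A B : Type} (f : A -> B) (l : list A) (l' : list B) :
  NoDup l -> (forall x, In x l -> In (f x) l') -> (length l' < length l)%nat ->
  exists x y, In x l /\ In y l /\ x <> y /\ f x = f y.
Proof.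
intros Hl Hf Hlen.
destruct (pigeonhole_rel (fun x c => f x = c) l Hl l') as (x & y & c & Hx & Hy & Hne & E & E');
  [eauto|exact Hlen|].
exists x, y; repeat split; congruence || assumption.
Qed.

Lemma mod_eq_divide m a b : 0 < m -> a mod m = b mod m -> (m | a - b).
Proof.
intros Hm H; apply Z.mod_divide; [lia|].
rewrite Zminus_mod, H, Z.sub_diag; apply Z.mod_0_l; lia.
Qed.

(** The differences of the points of a box with sides sqrt(a p) and sqrt(p / a) are
    small, and the box has more than p points; the stretching
    factor [a] adapts its shape to the form x^2 + n y^2 under study. *)
Lemma thue p s a : 1 < p -> 0 < a ->
  exists x y, (x <> 0 \/ y <> 0) /\ (p | x - s * y) /\
    x * x <= a * p /\ a * (y * y) <= p.
Proof.
intros Hp Ha.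
set (X := Z.sqrt (a * p)). set (Y := Z.sqrt (p / a)).
assert (HX : X * X <= a * p < (X + 1) * (X + 1)) by (apply Z.sqrt_spec; nia).
assert (Hq : 0 <= p / a) by (apply Z.div_pos; lia).
assert (HY : Y * Y <= p / a < (Y + 1) * (Y + 1)) by (apply Z.sqrt_spec; lia).
assert (HX0 : 0 <= X) by apply Z.sqrt_nonneg.
assert (HY0 : 0 <= Y) by apply Z.sqrt_nonneg.
assert (Hdiv : a * (p / a) <= p < a * (p / a) + a).
{ pose proof (Z.div_mod p a); pose proof (Z.mod_pos_bound p a); lia. }
assert (HY' : a * (Y * Y) <= p < a * ((Y+1) * (Y+1))) by nia.
clearbody X Y.
assert (Hbig : p < (X + 1) * (Y + 1)).
{ destruct (Z_lt_le_dec p ((X+1)*(Y+1))) as [|Hle]; [assumption|exfalso].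
  assert (Hsq : ((X+1)*(Y+1)) * ((X+1)*(Y+1)) <= p * p)
    by (apply Z.mul_le_mono_nonneg; lia).
  assert (H1 : (a*p) * (a*((Y+1)*(Y+1))) < ((X+1)*(X+1)) * (a*((Y+1)*(Y+1))))
    by (apply Z.mul_lt_mono_pos_r; lia).
  assert (H2 : (a*p) * p < (a*p) * (a*((Y+1)*(Y+1))))
    by (apply Z.mul_lt_mono_pos_l; lia).
  assert (H3 : a * (((X+1)*(Y+1)) * ((X+1)*(Y+1))) <= a * (p * p))
    by (apply Z.mul_le_mono_nonneg_l; lia).
  lia. }
destruct (pigeonhole (fun q : Z * Z => (fst q - s * snd q) mod p)
  (list_prod (below (X + 1)) (below (Y + 1))) (below p))
  as ([x1 y1] & [x2 y2] & H1 & H2 & Hne & E).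
- apply NoDup_pairs; apply NoDup_below.
- intros q _; apply in_below, Z.mod_pos_bound; lia.
- rewrite length_prod. apply Nat2Z.inj_lt. rewrite Nat2Z.inj_mul, !length_below; lia.
- apply in_prod_iff in H1, H2; rewrite !in_below in H1, H2.
  exists (x1 - x2), (y1 - y2). split; [|split; [|split]].
  + destruct (Z.eq_dec x1 x2), (Z.eq_dec y1 y2); try lia. subst; congruence.
  + apply mod_eq_divide in E; [|lia]. cbn in E.
    replace (x1 - x2 - s * (y1 - y2)) with (x1 - s * y1 - (x2 - s * y2)) by ring; exact E.
  + assert (Z.abs (x1-x2) <= X) by lia. nia.
  + assert (Z.abs (y1-y2) <= Y) by lia.
    transitivity (a * (Y * Y)); [|lia].
    apply Z.mul_le_mono_nonneg_l; nia.
Qed.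

Lemma thue_form p n a : 1 < p -> 0 < a -> residue p (-n) ->
  exists x y m, (x <> 0 \/ y <> 0) /\ x * x + n * (y * y) = m * p /\
    x * x <= a * p /\ a * (y * y) <= p.
Proof.
intros Hp Ha (s & c & Hs).
destruct (thue p s a Hp Ha) as (x & y & Hxy & (k & Hk) & Hx & Hy).
exists x, y. exists (k * (x + s * y) + c * (y * y)).
split; [exact Hxy|split; [|split; assumption]].
assert (Ex : x = s * y + k * p) by lia.
assert (E : s * s = c * p - n) by lia.
replace (x * x) with (s * s * (y*y) + k * p * (x + s * y)) by (rewrite Ex; ring).
rewrite E; ring.
Qed.

(** With p = 2h + 1, the h + 1 squares of 0, ..., h and the h products a v^2 with
    1 <= v <= h are p distinct classes modulo p, because a is not a square.  Hence b is
    one of them, and b = a v^2 makes a b the square of a v. *)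
Lemma nonresidue_mul p a b : prime p -> Z.odd p = true ->
  ~ residue p a -> residue p b \/ residue p (a * b).
Proof.
intros Hp Hodd Ha.
destruct (classic (residue p b)) as [|Hb]; [now left|right].
assert (Hp2 : 2 <= p) by (destruct Hp; lia).
apply Z.odd_spec in Hodd; destruct Hodd as [h Hh].
(* Points 0..h go to the squares, h+1..2h to the multiples a v^2, and the extra
   point -1 goes to b: p + 1 points in p classes. *)
destruct (pigeonhole (fun x => if Z_lt_le_dec h x then (a * ((x-h) * (x-h))) mod p
    else if Z_lt_le_dec x 0 then b mod p else (x * x) mod p)
  (-1 :: below (2 * h + 1)) (below p))
  as (x & y & Hx & Hy & Hne & E).
- constructor; [rewrite in_below; lia | apply NoDup_below].
- intros x _; apply in_below. destruct (Z_lt_le_dec h x), (Z_lt_le_dec x 0); apply Z.mod_pos_bound; lia.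
- cbn [length]. apply Nat2Z.inj_lt. rewrite Nat2Z.inj_succ, !length_below; lia.
- assert (Hx' : -1 <= x <= 2 * h) by (destruct Hx as [<-|Hx]; [|apply in_below in Hx]; lia).
  assert (Hy' : -1 <= y <= 2 * h) by (destruct Hy as [<-|Hy]; [|apply in_below in Hy]; lia).
  clear Hx Hy.
  assert (small : forall z, (p | z) -> -p < z < p -> z = 0).
  { intros z [k ->] Hz. assert (k <= -1 \/ k = 0 \/ 1 <= k) as [|[->|]] by lia; nia. }
  assert (sq : forall u v, 0 <= u <= h -> 0 <= v <= h -> (p | u*u - v*v) -> u = v).
  { intros u v Hu Hv D. replace (u*u-v*v) with ((u-v)*(u+v)) in D by ring.
    apply prime_mult in D; [|assumption].
    destruct D as [D|D]; apply small in D; lia. }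
  assert (inv : forall u, 0 < u <= h -> exists w, (p | u * w - 1)).
  { intros u Hu. assert (R : rel_prime u p).
    { apply rel_prime_sym, prime_rel_prime; [assumption|]. intro D; apply small in D; lia. }
    apply rel_prime_bezout in R; destruct R as [w q R]. exists w, (-q). lia. }
  assert (mix : forall u v, 0 <= u <= h -> 0 < v <= h -> (p | u*u - a*(v*v)) -> False).
  { intros u v Hu Hv [k D]. destruct (inv v Hv) as [w [q W]]. apply Ha.
    exists (u * w). exists (k*w*w + a * q * (v*w+1)).
    replace (u*w*(u*w) - a) with (w*w*(u*u-a*(v*v)) + a * ((v*w-1)*(v*w+1))) by ring.
    rewrite D. replace (v*w-1) with (q*p) by lia. ring. }
  assert (mixb : forall v, 0 <= v <= h -> (p | b - v * v) -> False).
  { intros v Hv [k D]. apply Hb; exists v, (-k); lia. }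
  assert (good : forall v, 0 <= v <= h -> (p | b - a*(v*v)) -> residue p (a*b)).
  { intros v Hv [k D]. exists (a*v), (-a*k). 
    replace (a*v*(a*v) - a*b) with (-a*(b-a*(v*v))) by ring. rewrite D; ring. }
  assert (flip : forall u v, (p | u - v) -> (p | v - u)).
  { intros u v [k D]; exists (-k); lia. }
  destruct (Z_lt_le_dec h x), (Z_lt_le_dec h y), (Z_lt_le_dec x 0), (Z_lt_le_dec y 0);
    try lia; apply mod_eq_divide in E; try lia.
  + exfalso. replace (a*((x-h)*(x-h)) - a*((y-h)*(y-h))) with (a*((x-h)*(x-h)-(y-h)*(y-h))) in E by ring.
    apply prime_mult in E; [|assumption]. destruct E as [E|E].
    * apply Ha. exists 0. destruct E as [k ->]; exists (-k); ring.
    * apply sq in E; lia.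
  + apply flip in E; apply (good (x-h)); [lia|assumption].
  + exfalso; apply flip in E; apply mix in E; lia.
  + apply (good (y-h)); [lia|assumption].
  + exfalso; apply mix in E; lia.
  + exfalso; apply mixb in E; lia.
  + exfalso; apply flip, mixb in E; lia.
  + exfalso; apply sq in E; lia.
Qed.

(** * Positive ternary forms of determinant 10 *)

Definition ternary (a b c d e f x y z : Z) : Z :=
  a*x*x + b*y*y + c*z*z + 2*d*y*z + 2*e*x*z + 2*f*x*y.

Definition ternary_det (a b c d e f : Z) : Z :=
  a*b*c + 2*d*e*f - a*d*d - b*e*e - c*f*f.

(** A form enters the reduction only through its set of values: this is what the
    conclusion speaks of, and it does not change when the basis does. *)
Definition has_values (V : Z -> Prop) (a b c d e f : Z) : Prop :=
  forall n, V n <-> exists x y z, ternary a b c d e f x y z = n.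

Lemma centered_shift (m n : Z) : 0 < m -> exists k, 2 * Z.abs (n + k * m) <= m.
Proof.
intro Hm.
exists (- ((2 * n + m) / (2 * m))).
pose proof (Z.div_mod (2*n+m) (2*m)). pose proof (Z.mod_pos_bound (2*n+m) (2*m)).
nia.
Qed.

Lemma shift_x_by_y V a b c d e f k : has_values V a b c d e f ->
  has_values V a (b + 2*k*f + k*k*a) c (d + k*e) e (f + k*a).
Proof.
intros H n; rewrite (H n); split; intros (x & y & z & <-).
- exists (x - k*y), y, z; unfold ternary; ring.
- exists (x + k*y), y, z; unfold ternary; ring.
Qed.

Lemma shift_x_by_z V a b c d e f k : has_values V a b c d e f ->
  has_values V a b (c + 2*k*e + k*k*a) (d + k*f) (e + k*a) f.
Proof.
intros H n; rewrite (H n); split; intros (x & y & z & <-).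
- exists (x - k*z), y, z; unfold ternary; ring.
- exists (x + k*z), y, z; unfold ternary; ring.
Qed.

Lemma shift_y_by_z V a b c d e f k : has_values V a b c d e f ->
  has_values V a b (c + 2*k*d + k*k*b) (d + k*b) (e + k*f) f.
Proof.
intros H n; rewrite (H n); split; intros (x & y & z & <-).
- exists x, (y - k*z), z; unfold ternary; ring.
- exists x, (y + k*z), z; unfold ternary; ring.
Qed.

Lemma swap_x_y V a b c d e f :
  has_values V a b c d e f -> has_values V b a c e d f.
Proof.
intros H n; rewrite (H n); split; intros (x & y & z & <-);
  exists y, x, z; unfold ternary; ring.
Qed.

Lemma swap_y_z V a b c d e f :
  has_values V a b c d e f -> has_values V a c b d f e.
Proof.
intros H n; rewrite (H n); split; intros (x & y & z & <-);
  exists x, z, y; unfold ternary; ring.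
Qed.

(** Completing the square in x turns a times the form into
    (ax + fy + ez)^2 + M y^2 + 2(ad - ef) yz + (ac - e^2) z^2 with M = ab - f^2.
    Shearing z by y, then y by x, then z by x reduces the middle coefficients one
    after the other without touching a, M or what was already reduced. *)
Lemma size_reduce V a b c d e f :
  0 < a -> 0 < a*b - f*f -> has_values V a b c d e f ->
  exists b' c' d' e' f',
    has_values V a b' c' d' e' f' /\
    ternary_det a b' c' d' e' f' = ternary_det a b c d e f /\
    a*b' - f'*f' = a*b - f*f /\
    2 * Z.abs f' <= a /\ 2 * Z.abs e' <= a /\
    2 * Z.abs (a*d' - e'*f') <= a*b - f*f.
Proof.
intros Ha Hm HV.
destruct (centered_shift _ (a*d - e*f) Hm) as [k1 H1].
destruct (centered_shift _ f Ha) as [k2 H2].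
destruct (centered_shift _ (e + k1*f) Ha) as [k3 H3].
pose proof (shift_x_by_z _ _ _ _ _ _ _ k3
  (shift_x_by_y _ _ _ _ _ _ _ k2 (shift_y_by_z _ _ _ _ _ _ _ k1 HV))) as HV'.
do 5 eexists; split; [exact HV'|].
split; [unfold ternary_det; ring|].
split; [ring|].
split; [exact H2|].
split; [exact H3|].
eapply Z.le_trans; [|exact H1].
apply Z.eq_le_incl; do 2 f_equal; ring.
Qed.

(** Hermite's inequalities: the binary form (M, ad - ef, ac - e^2) above has
    determinant 10a, so its reducedness bounds M, and M bounds a. *)
Lemma reduced_bounds a b c d e f :
  0 < a -> a <= b -> 0 < a*b - f*f ->
  ternary_det a b c d e f = 10 ->
  2 * Z.abs f <= a -> 2 * Z.abs (a*d - e*f) <= a*b - f*f ->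
  a*b - f*f <= a*c - e*e ->
  a <= 2 /\ 3 * ((a*b - f*f) * (a*b - f*f)) <= 40 * a.
Proof.
intros Ha Hab Hm Hdet Hf Hd Hc.
assert (E : (a*b-f*f)*(a*c-e*e) - (a*d-e*f)*(a*d-e*f) = 10 * a).
{ rewrite <- Hdet; unfold ternary_det; ring. }
set (M := a*b-f*f) in *; set (N := a*c-e*e) in *; set (g := a*d-e*f) in *.
assert (HM : 3 * (M * M) <= 40 * a) by nia.
split; [|exact HM].
assert (H3 : 3 * (a * a) <= 4 * M).
{ unfold M. nia. }
clear - Ha Hm HM H3; clearbody M.
assert (H9 : (3*(a*a)) * (3*(a*a)) <= (4*M)*(4*M))
  by (apply Z.mul_le_mono_nonneg; nia).
destruct (Z_lt_le_dec 2 a) as [Ha3|]; [exfalso|assumption].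
assert (9 <= a*a) by nia.
assert (27 * a <= (a*a)*(a*a)) by (replace ((a*a)*(a*a)) with (a*a*a*a) by ring; nia).
nia.
Qed.

(** The reduced positive forms of determinant 10 with an odd value are
    x^2 + y^2 + 10z^2, x^2 + 2y^2 + 5z^2 and the sum of 2x^2 and a binary form of
    determinant 5.  The first has the value 15 and the last the value 10, while [V5]
    forbids 5m with m = 2 or 3 modulo 5: only the second survives.  The induction on
    (a, M), lexicographically, is the termination of the reduction: exchanging x and
    y lowers a when b < a, exchanging y and z keeps a and lowers M = ab - f^2. *)
Lemma ternary_det_10 (V : Z -> Prop)
  (Vodd : exists n, V n /\ Z.odd n = true)
  (V5 : forall m, V (5 * m) -> m mod 5 = 0 \/ m mod 5 = 1 \/ m mod 5 = 4) :
  forall a, 1 <= a -> forall M, 1 <= M -> forall b c d e f,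
  M = a*b - f*f -> ternary_det a b c d e f = 10 -> has_values V a b c d e f ->
  forall n, V n -> exists x y z, n = x*x + 2*(y*y) + 5*(z*z).
Proof.
refine (Zlt_lower_bound_ind _ 1 _); intros a IHa Ha.
refine (Zlt_lower_bound_ind _ 1 _); intros M IHM HM b0 c0 d0 e0 f0 EM Hdet0 HV0.
destruct (size_reduce V a b0 c0 d0 e0 f0)
  as (b & c & d & e & f & HV & Hdet & Hm & Hf & He & Hd); [lia|lia|exact HV0|].
rewrite Hdet0 in Hdet.
rewrite <- Hm in EM, Hd. clear b0 c0 d0 e0 f0 Hdet0 HV0 Hm.
destruct (Z_lt_le_dec b a) as [Hba|Hab].
{ assert (0 < b) by (apply (Z.mul_pos_cancel_l a); [lia|]; pose proof (Z.square_nonneg f); lia).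
  apply (IHa b) with (M := M) (b := a) (c := c) (d := e) (e := d) (f := f);
    try lia; [|apply swap_x_y, HV].
  rewrite <- Hdet; unfold ternary_det; ring. }
destruct (Z_lt_le_dec (a*c - e*e) M) as [HNM|HMN].
{ assert (E : M*(a*c-e*e) - (a*d-e*f)*(a*d-e*f) = 10 * a).
  { rewrite <- Hdet, EM; unfold ternary_det; ring. }
  assert (0 < a*c - e*e) by (apply (Z.mul_pos_cancel_l M); [lia|]; pose proof (Z.square_nonneg (a*d-e*f)); lia).
  apply (IHM (a*c - e*e)) with (b := c) (c := b) (d := d) (e := f) (f := e);
    try lia; [|apply swap_y_z, HV].
  rewrite <- Hdet; unfold ternary_det; ring. }
destruct (reduced_bounds a b c d e f) as [Ha2 HM2]; try lia.
rewrite <- EM in HM2.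
assert (HM5 : M <= 5) by nia.
assert (Hcase : a = 1 \/ a = 2) by lia.
destruct Hcase as [-> | ->].
- assert (f = 0) by lia; assert (e = 0) by lia; subst f e.
  assert (HM3 : M <= 3) by nia.
  assert (Hbc : b*c - d*d = 10) by (unfold ternary_det in Hdet; lia).
  assert (Hb : b = 1 \/ b = 2 \/ b = 3) by lia.
  destruct Hb as [-> | [-> | ->]].
  + assert (d = 0) by lia; subst d.
    exfalso. specialize (V5 3). destruct V5 as [V5'|[V5'|V5']]; try (discriminate V5').
    apply HV. exists 1, 2, 1. unfold ternary. lia.
  + assert (Hd1 : d = 0 \/ d = 1 \/ d = -1) by lia.
    destruct Hd1 as [-> | [-> | ->]]; try lia.
    intros n Hn. apply HV in Hn. destruct Hn as (x & y & z & <-).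
    exists x, y, z. unfold ternary. replace c with 5 by lia. ring.
  + assert (Hd1 : d = 0 \/ d = 1 \/ d = -1) by lia.
    destruct Hd1 as [-> | [-> | ->]]; lia.
- exfalso.
  assert (Hf1 : f = 0 \/ f = 1 \/ f = -1) by lia.
  assert (He1 : e = 0 \/ e = 1 \/ e = -1) by lia.
  assert (Hbs : b = 2 \/ b = 3) by (destruct Hf1 as [-> | [-> | ->]]; lia).
  unfold ternary_det in Hdet.
  assert (Hds : -3 <= d <= 3) by (destruct Hf1 as [-> | [-> | ->]]; destruct He1 as [-> | [-> | ->]]; destruct Hbs as [-> | ->]; lia).
  assert (Hd1 : d = -3 \/ d = -2 \/ d = -1 \/ d = 0 \/ d = 1 \/ d = 2 \/ d = 3) by lia.
  (* What remains is a = 2, with M = 3, 4 or 5.  Either b and c are even, and then all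
     values are; or b = 2 and f = 0, and then the form takes the value 10. *)
  assert (Hno10 : ~ V 10).
  { intro H. specialize (V5 2 H). destruct V5 as [V5'|[V5'|V5']]; discriminate V5'. }
  assert (Hodd : Z.even b = true -> Z.even c = true -> False).
  { intros Eb Ec. destruct Vodd as (n & Hn & On). apply HV in Hn.
    destruct Hn as (x & y & z & <-). unfold ternary in On.
    rewrite !Z.odd_add, !Z.odd_mul in On.
    rewrite <- !Z.negb_even, Eb, Ec in On. simpl in On.
    discriminate. }
  clear - Hf1 He1 Hbs Hd1 Hdet Hd HMN EM Hno10 Hodd HV.
  assert (K : (b = 2 /\ c = 4) \/ (b = 2 /\ f = 0)).
  { destruct Hf1 as [-> | [-> | ->]]; destruct He1 as [-> | [-> | ->]]; destruct Hbs as [-> | ->];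
     repeat (destruct Hd1 as [-> | Hd1]); lia. }
  destruct K as [[-> ->] | [-> ->]].
  + now apply Hodd.
  + apply Hno10, HV. exists 2, 1, 0. unfold ternary. lia.
Qed.

(** * Ideal classes of Z[sqrt(-D)] *)

(** Pairs stand for elements x + y sqrt(-D). *)
Definition qmul (D : Z) (u v : Z * Z) : Z * Z :=
  (fst u * fst v - D * (snd u * snd v), fst u * snd v + snd u * fst v).

Definition qadd (u v : Z * Z) : Z * Z := (fst u + fst v, snd u + snd v).

Definition qnorm (D : Z) (u : Z * Z) : Z := fst u * fst u + D * (snd u * snd u).

Lemma qmulC D u v : qmul D u v = qmul D v u.
Proof. unfold qmul; f_equal; ring. Qed.

Lemma qmulA D u v w : qmul D u (qmul D v w) = qmul D (qmul D u v) w.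
Proof. unfold qmul, fst, snd; f_equal; ring. Qed.

Lemma qmulDr D u v w : qmul D u (qadd v w) = qadd (qmul D u v) (qmul D u w).
Proof. unfold qmul, qadd; cbn; f_equal; ring. Qed.

Lemma qmulACA D u v w z :
  qmul D (qmul D u v) (qmul D w z) = qmul D (qmul D u w) (qmul D v z).
Proof. unfold qmul, fst, snd; f_equal; ring. Qed.

Lemma qnorm_mul D u v : qnorm D (qmul D u v) = qnorm D u * qnorm D v.
Proof. unfold qnorm, qmul; cbn; ring. Qed.

Lemma qnorm_mul_neq0 D u v :
  qnorm D u <> 0 -> qnorm D v <> 0 -> qnorm D (qmul D u v) <> 0.
Proof. rewrite qnorm_mul; intros Hu Hv; apply Z.neq_mul_0; auto. Qed.

(** A scalar counts as nonzero when its norm is, which is a multiplicative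
    condition. *)
Definition same_class (D : Z) (I J : Z * Z -> Prop) : Prop :=
  exists a b, qnorm D a <> 0 /\ qnorm D b <> 0 /\
    (forall i, I i -> exists j, J j /\ qmul D a i = qmul D b j) /\
    (forall j, J j -> exists i, I i /\ qmul D a i = qmul D b j).

(** Finite sums of products.  Scalars are not adjoined, since they can be absorbed in
    a factor when I is an ideal. *)
Inductive square (D : Z) (I : Z * Z -> Prop) : Z * Z -> Prop :=
| square_mul i j : I i -> I j -> square D I (qmul D i j)
| square_add u v : square D I u -> square D I v -> square D I (qadd u v).

Lemma same_class_ext D I J : (forall z, I z <-> J z) -> same_class D I J.
Proof.
intro H. exists (1, 0), (1, 0). split; [|split; [|split]]; try (unfold qnorm, fst, snd; lia).
- intros i Hi; exists i; split; [now apply H | reflexivity].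
- intros j Hj; exists j; split; [now apply H | reflexivity].
Qed.

Lemma same_class_sym D I J : same_class D I J -> same_class D J I.
Proof.
intros (a & b & Ha & Hb & F & G). exists b, a; repeat split; try assumption.
- intros j Hj; destruct (G j Hj) as (i & Hi & E); eauto.
- intros i Hi; destruct (F i Hi) as (j & Hj & E); eauto.
Qed.

Lemma same_class_trans D I J K : same_class D I J -> same_class D J K -> same_class D I K.
Proof.
intros (a & b & Ha & Hb & F & G) (c & d & Hc & Hd & F' & G').
assert (E3 : forall i j k, qmul D a i = qmul D b j -> qmul D c j = qmul D d k ->
  qmul D (qmul D c a) i = qmul D (qmul D b d) k).
{ intros i j k E E'. rewrite <- !qmulA, E, <- E', !qmulA.
  now rewrite (qmulC D c b). }
exists (qmul D c a), (qmul D b d); repeat split; try now apply qnorm_mul_neq0.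
- intros i Hi. destruct (F i Hi) as (j & Hj & E). destruct (F' j Hj) as (k & Hk & E'). eauto.
- intros k Hk. destruct (G' k Hk) as (j & Hj & E'). destruct (G j Hj) as (i & Hi & E). eauto.
Qed.

(** Working with sets of elements makes this immediate; it replaces the composition
    law of binary forms. *)
Lemma same_class_square D I J : same_class D I J -> same_class D (square D I) (square D J).
Proof.
intros (a & b & Ha & Hb & F & G).
exists (qmul D a a), (qmul D b b); repeat split; try now apply qnorm_mul_neq0.
- intros z Hz; induction Hz as [i i' Hi Hi' | u v _ (u' & Hu & Eu) _ (v' & Hv & Ev)].
  + destruct (F i Hi) as (j & Hj & E), (F i' Hi') as (j' & Hj' & E').
    exists (qmul D j j'); split; [now apply square_mul|].
    now rewrite qmulACA, E, E', qmulACA.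
  + exists (qadd u' v'); split; [now apply square_add|]. now rewrite !qmulDr, Eu, Ev.
- intros z Hz; induction Hz as [j j' Hj Hj' | u v _ (u' & Hu & Eu) _ (v' & Hv & Ev)].
  + destruct (G j Hj) as (i & Hi & E), (G j' Hj') as (i' & Hi' & E').
    exists (qmul D i i'); split; [now apply square_mul|].
    now rewrite qmulACA, E, E', qmulACA.
  + exists (qadd u' v'); split; [now apply square_add|]. now rewrite !qmulDr, Eu, Ev.
Qed.

(** For w dividing b^2 + D this is the ideal with basis w, b + sqrt(-D), written as a
    congruence. *)
Definition ideal (w b : Z) : Z * Z -> Prop := fun z => (w | fst z - b * snd z).

(** A change of basis of the norm form [w, 2b, c] is a multiplication of ideals: if
    rho = k w + y (b + sqrt(-D)) is the first new basis vector, multiplying by its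
    conjugate and dividing by w gives an ideal whose first basis vector is the
    integer N(rho) / w. *)
Lemma same_class_ideal_basis D w c b k y k' y' :
  w * c = b * b + D -> w <> 0 -> k * y' - k' * y = 1 ->
  w * (k * k) + 2 * b * (k * y) + c * (y * y) <> 0 ->
  same_class D (ideal w b)
    (ideal (w * (k * k) + 2 * b * (k * y) + c * (y * y))
         (w * (k * k') + b * (k * y' + k' * y) + c * (y * y'))).
Proof.
intros Hc Hw Hdet Hw'.
set (w' := w * (k * k) + 2 * b * (k * y) + c * (y * y)) in *.
set (b' := w * (k * k') + b * (k * y' + k' * y) + c * (y * y')).
assert (ED : D = w * c - b * b) by lia.
assert (key : forall X Y, qmul D (k * w + b * y, - y) (w * X + b * Y, Y) =
   qmul D (w, 0) ((X * y' - Y * k') * w' + (k * Y - y * X) * b', k * Y - y * X)).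
{ intros X Y. unfold qmul, fst, snd; f_equal; [|ring].
  transitivity (w * (X * (w * k + b * y) + Y * (k * b + c * y))); [rewrite ED; ring|].
  replace (X * (w * k + b * y) + Y * (k * b + c * y)) with
   ((k * y' - k' * y) * (X * (w * k + b * y) + Y * (k * b + c * y))) by (rewrite Hdet; ring).
  unfold w', b'; ring. }
exists (k * w + b * y, - y), (w, 0).
split; [|split; [|split]].
- replace (qnorm D _) with (w * w') by (unfold qnorm, w', fst, snd; rewrite ED; ring).
  apply Z.neq_mul_0; auto.
- unfold qnorm, fst, snd. nia.
- intros [i1 Y] [X HX]; cbn in HX.
  exists ((X * y' - Y * k') * w' + (k * Y - y * X) * b', k * Y - y * X); split.
  + exists (X * y' - Y * k'); cbn; ring.
  + rewrite <- key. do 2 f_equal; lia.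
- intros [j1 n] [m Hm]; cbn in Hm.
  set (X := m * k + n * k'). set (Y := m * y + n * y').
  exists (w * X + b * Y, Y); split.
  + exists X; cbn; ring.
  + rewrite key. f_equal.
    assert (E1 : X * y' - Y * k' = m).
    { transitivity (m * (k * y' - k' * y)); [unfold X, Y; ring|]. rewrite Hdet; ring. }
    assert (E2 : k * Y - y * X = n).
    { transitivity (n * (k * y' - k' * y)); [unfold X, Y; ring|]. rewrite Hdet; ring. }
    rewrite E1, E2. f_equal; lia.
Qed.

Lemma ideal_shift w b k z : ideal w (b + k * w) z <-> ideal w b z.
Proof.
unfold ideal; split; intros [q Hq].
- exists (q + k * snd z); lia.
- exists (q - k * snd z); lia.
Qed.

(** Gauss reduction of the norm form: center b modulo w, and exchange w and c as long
    as c < w. *)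
Lemma same_class_ideal_reduced D : 0 < D -> forall w, 1 <= w -> forall b, (w | b * b + D) ->
  exists w0 b0, 0 < w0 <= 2 * D /\ - D <= b0 <= D /\
    same_class D (ideal w b) (ideal w0 b0).
Proof.
intro HD.
refine (Zlt_lower_bound_ind _ 1 _); intros w IH Hw b Hb.
destruct (centered_shift w b) as [k Hk]; [lia|].
set (b1 := b + k * w) in *.
assert (Hb1 : (w | b1 * b1 + D)).
{ replace (b1 * b1 + D) with (b * b + D + k * (b + b1) * w) by (unfold b1; ring).
  apply Z.divide_add_r; [exact Hb | apply Z.divide_factor_r]. }
assert (S : same_class D (ideal w b) (ideal w b1)).
{ apply same_class_ext; intro z; symmetry; apply ideal_shift. }
clearbody b1. destruct Hb1 as [c Hc].
destruct (Z_lt_le_dec c w) as [Hcw|Hcw].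
- assert (0 < c).
  { apply (Z.mul_pos_cancel_r c w); [lia|]. rewrite <- Hc; nia. }
  destruct (IH c) with (b := - b1) as (w0 & b0 & H0 & H1 & S'); [lia| |].
  { exists w; lia. }
  exists w0, b0; repeat split; try lia.
  apply (same_class_trans _ _ _ _ S). refine (same_class_trans _ _ _ _ _ S').
  pose proof (same_class_ideal_basis D w c b1 0 1 (-1) 0) as B.
  replace (w * (0 * 0) + 2 * b1 * (0 * 1) + c * (1 * 1)) with c in B by ring.
  replace (w * (0 * -1) + b1 * (0 * 0 + -1 * 1) + c * (1 * 0)) with (- b1) in B by ring.
  apply B; lia.
- assert (Hw2 : 4 * (b1 * b1) <= w * w) by (clear - Hk Hw; nia).
  assert (Hw3 : w * w <= w * c) by nia.
  assert (w <= 2 * D) by nia.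
  exists w, b1; repeat split; try lia; exact S.
Qed.

(** 2p is 2 modulo 4 and squarefree, so a square divisor of b^2 + 2p can share no
    factor with 2b. *)
Lemma rel_prime_of_square_divide p v b : prime p -> Z.odd p = true ->
  (v * v | b * b + 2 * p) -> rel_prime v (2 * b) /\ Z.odd v = true /\ ~ (p | v).
Proof.
intros Hp Hpo [c Hc].
assert (Hp2 : 2 <= p) by (destruct Hp; lia).
assert (Hv : Z.odd v = true).
{ destruct (Z.odd v) eqn:E; [reflexivity|exfalso].
  rewrite <- Z.negb_even in E. apply Bool.negb_false_iff, Z.even_spec in E.
  destruct E as [v1 ->]. apply Z.odd_spec in Hpo; destruct Hpo as [h ->].
  destruct (Z.Even_or_Odd b) as [[b1 ->]|[b1 ->]]; lia. }
assert (Hg : forall g, (g | v) -> (g | b) -> (g | 1)).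
{ intros g [v1 ->] [b1 ->].
  assert (Hgo : Z.odd g = true).
  { rewrite Z.odd_mul in Hv; apply andb_prop in Hv; tauto. }
  assert (D2 : (g * g | 2 * p)).
  { exists (c * v1 * v1 - b1 * b1); lia. }
  assert (D1 : (g * g | p)).
  { apply Z.gauss with 2; [exact D2|]. apply Zgcd_1_rel_prime.
    apply rel_prime_sym, prime_rel_prime; [apply prime_2|].
    intros [q Hq]. assert (Z.odd (g * g) = true) by (rewrite Z.odd_mul, Hgo; reflexivity).
    rewrite Hq, Z.odd_mul, Bool.andb_false_r in H; discriminate. }
  assert (D0 : (g | p)) by (destruct D1 as [q ->]; exists (q * g); ring).
  destruct (prime_divisors p Hp g D0) as [-> | [-> | Hgp]]; [exists (-1); ring|exists 1; ring|exfalso].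
  assert (g * g = p * p) by (destruct Hgp; subst; ring).
  rewrite H in D1. destruct D1 as [q Hq].
  assert (Hqp : q * p = 1) by (apply Z.mul_cancel_r with p; lia).
  assert (q <= 0 \/ 1 <= q) as [|] by lia; nia. }
split; [|split; [exact Hv|]].
- constructor; [exists v; ring|exists (2*b); ring|].
  intros g Hgv Hgb. apply Hg; [exact Hgv|].
  apply Z.gauss with 2; [exact Hgb|]. apply Zgcd_1_rel_prime.
  apply rel_prime_sym, prime_rel_prime; [apply prime_2|].
  intro H2. assert (H : (2 | v)) by (eapply Z.divide_trans; eassumption).
  destruct H as [q ->]. rewrite Z.odd_mul, Bool.andb_false_r in Hv; discriminate.
- intro Hpv. assert (Hpb : (p | b)).
  { destruct Hpv as [q ->]. assert (D : (p | b * b)) by (exists (c*q*q*p - 2); lia).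
    apply prime_mult in D; tauto. }
  destruct (Hg p Hpv Hpb) as [q Hq].
  assert (q <= 0 \/ 1 <= q) as [|] by lia; nia.
Qed.

(** With theta = b + sqrt(-D), the square is spanned by v^2, v theta and
    theta^2 = 2b theta - (b^2 + D), and v and 2b are coprime. *)
Lemma square_ideal D v b : rel_prime v (2 * b) -> (v * v | b * b + D) ->
  forall z, square D (ideal v b) z <-> ideal (v * v) b z.
Proof.
intros Hr [c Hc] z; split.
- intro Hz; induction Hz as [[x y] [x' y'] [k Hk] [k' Hk'] | u u' _ [m Hm] _ [m' Hm']].
  + cbn in Hk, Hk'. exists (k * k' - c * (y * y')). unfold qmul, fst, snd.
    replace x with (b * y + k * v) by lia. replace x' with (b * y' + k' * v) by lia.
    replace D with (c * (v * v) - b * b) by lia. ring.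
  + exists (m + m'). unfold qadd; cbn. lia.
- apply rel_prime_bezout in Hr; destruct Hr as [s t Hst].
  destruct z as [x y]; intros [k Hk]; cbn in Hk.
  replace (x, y) with
   (qadd (qmul D (v, 0) ((k + y * t * c) * v, 0))
    (qadd (qmul D (v, 0) (y * s * b, y * s))
     (qmul D (b, 1) (y * t * b, y * t)))).
  + repeat apply square_add; apply square_mul; unfold ideal; cbn.
    * exists 1; ring.
    * exists (k + y * t * c); ring.
    * exists 1; ring.
    * exists 0; ring.
    * exists 0; ring.
    * exists 0; ring.
  + unfold qadd, qmul, fst, snd; f_equal.
    * replace D with (c * (v * v) - b * b) by lia.
      transitivity (b * y * (s * v + t * (2 * b)) + k * (v * v)); [ring|].
      rewrite Hst; lia.
    * transitivity (y * (s * v + t * (2 * b))); [ring|]. rewrite Hst; ring.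
Qed.

Lemma square_divide a b : (a * a | b * b) -> (a | b).
Proof.
intros [c H].
destruct (Z.eq_dec a 0) as [->|Ha]; [exists 0; nia|].
set (g := Z.gcd a b).
assert (Hg : g <> 0) by (unfold g; intro E; apply Z.gcd_eq_0 in E; tauto).
destruct (Z.gcd_divide_l a b) as [a1 Ha1]. destruct (Z.gcd_divide_r a b) as [b1 Hb1].
fold g in Ha1, Hb1.
assert (G1 : Z.gcd a1 b1 = 1).
{ pose proof (Z.gcd_div_gcd a b g Hg eq_refl) as E.
  rewrite Ha1, Hb1, !Z.div_mul in E by assumption. exact E. }
assert (E : b1 * b1 = c * (a1 * a1)).
{ apply Z.mul_cancel_r with (g * g); [nia|]. rewrite Ha1, Hb1 in H. lia. }
assert (D : (a1 | b1)).
{ apply Z.gauss with b1; [exists (c * a1); lia | exact G1]. }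
rewrite Ha1, Hb1. now apply Z.mul_divide_mono_r.
Qed.

(** If the norm form [w, 2b, c] takes the value v^2, it does so primitively after
    division by the gcd of the arguments.  Then it is equivalent to some
    [v^2, 2b', c'], which is the square of [v, 2b', v c']. *)
Lemma ideal_square_root p w c b k y v : prime p -> Z.odd p = true ->
  w * c = b * b + 2 * p -> w <> 0 -> v <> 0 ->
  w * (k * k) + 2 * b * (k * y) + c * (y * y) = v * v ->
  exists v' b', 0 < v' /\ Z.odd v' = true /\ ~ (p | v') /\ (v' | b' * b' + 2 * p) /\
    same_class (2 * p) (square (2 * p) (ideal v' b')) (ideal w b).
Proof.
intros Hp Hpo Hc Hw Hv E.
set (g := Z.gcd k y).
destruct (Z.gcd_divide_l k y) as [k0 Hk]. destruct (Z.gcd_divide_r k y) as [y0 Hy].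
fold g in Hk, Hy.
assert (Hg : g <> 0) by (intro E0; rewrite E0 in *; nia).
assert (G1 : Z.gcd k0 y0 = 1).
{ pose proof (Z.gcd_div_gcd k y g Hg eq_refl) as E1.
  rewrite Hk, Hy, !Z.div_mul in E1 by assumption. exact E1. }
assert (Dv : (g | v)).
{ apply square_divide. exists (w * (k0 * k0) + 2 * b * (k0 * y0) + c * (y0 * y0)).
  rewrite <- E, Hk, Hy; ring. }
destruct Dv as [v0 Hv0].
assert (E0 : w * (k0 * k0) + 2 * b * (k0 * y0) + c * (y0 * y0) = v0 * v0).
{ apply Z.mul_cancel_r with (g * g); [nia|].
  transitivity (v * v); [rewrite <- E, Hk, Hy|rewrite Hv0]; ring. }
apply Zgcd_1_rel_prime, rel_prime_bezout in G1. destruct G1 as [y' k' Hdet].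
assert (Hdet' : k0 * y' - (- k') * y0 = 1) by lia.
assert (Hv00 : v0 <> 0) by (intros ->; lia).
pose proof (same_class_ideal_basis (2 * p) w c b k0 y0 (- k') y' Hc Hw Hdet') as S.
rewrite E0 in S. specialize (S ltac:(nia)).
set (b' := w * (k0 * - k') + b * (k0 * y' + - k' * y0) + c * (y0 * y')) in *.
assert (Db : (Z.abs v0 * Z.abs v0 | b' * b' + 2 * p)).
{ exists (w * (k' * k') - 2 * b * (k' * y') + c * (y' * y')).
  rewrite <- Z.abs_mul, Z.abs_eq, <- E0 by nia.
  replace (2 * p) with ((w * c - b * b) * ((k0 * y' - - k' * y0) * (k0 * y' - - k' * y0)))
    by (rewrite Hdet'; lia).
  unfold b'; ring. }
destruct (rel_prime_of_square_divide p (Z.abs v0) b' Hp Hpo Db) as (R & O & N).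
exists (Z.abs v0), b'. repeat split; try assumption; try lia.
- eapply Z.divide_trans; [|exact Db]. apply Z.divide_factor_l.
- apply same_class_sym. apply (same_class_trans _ _ _ _ S), same_class_sym, same_class_ext.
  intro z. rewrite square_ideal; [|exact R|exact Db].
  rewrite <- Z.abs_mul, Z.abs_eq by nia. reflexivity.
Qed.

(** * Square roots of ideal classes *)

Lemma floor_sqrt n : 0 <= n -> exists s, 0 <= s /\ s * s <= n < (s + 1) * (s + 1).
Proof.
intro Hn; exists (Z.sqrt n). split; [apply Z.sqrt_nonneg | now apply Z.sqrt_spec].
Qed.

(** The number of points of the box used in [legendre], compared through squares
    because its sides are rounded square roots. *)
Lemma legendre_box_count w p X Y U :
  0 < w -> 0 < p -> 0 <= X -> 0 <= Y -> 0 <= U ->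
  2 * p * w < (X + 1) * (X + 1) -> w < (Y + 1) * (Y + 1) -> 2 * p < (U + 1) * (U + 1) ->
  w * (2 * p) < (X + 1) * ((Y + 1) * (U + 1)).
Proof.
intros Hw Hp HX HY HU H1 H2 H3.
destruct (Z_lt_le_dec (w * (2 * p)) ((X + 1) * ((Y + 1) * (U + 1)))) as [|Hle]; [assumption|exfalso].
assert (Hsq : ((X+1)*((Y+1)*(U+1))) * ((X+1)*((Y+1)*(U+1))) <= (w*(2*p)) * (w*(2*p))).
{ apply Z.mul_le_mono_nonneg; try lia; repeat apply Z.mul_nonneg_nonneg; lia. }
assert (H4 : w * (2*p) < ((Y+1)*(Y+1)) * ((U+1)*(U+1))) by (apply Z.mul_lt_mono_nonneg; lia).
assert (H5 : (2*p*w) * (w*(2*p)) < ((X+1)*(X+1)) * (((Y+1)*(Y+1))*((U+1)*(U+1)))).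
{ apply Z.mul_lt_mono_nonneg; try lia.
  all: repeat apply Z.mul_nonneg_nonneg; lia. }
lia.
Qed.

Lemma odd_sqrt_mod_2p p w r : Z.odd p = true -> Z.odd w = true -> (p | r * r - w) ->
  exists s, (2 * p | s * s - w).
Proof.
intros Hp Hw [q Hq].
assert (E : exists s, Z.odd s = true /\ (p | s * s - w)).
{ destruct (Z.odd r) eqn:Hr.
  - exists r; split; [exact Hr | exists q; lia].
  - exists (r + p); split; [now rewrite Z.odd_add, Hr, Hp | exists (q + 2 * r + p); lia]. }
destruct E as (s & Hs & [k Hk]). exists s.
assert (Hk2 : Z.odd (k * p) = false).
{ rewrite <- Hk, Z.odd_sub, Z.odd_mul, Hs, Hw. reflexivity. }
rewrite Z.odd_mul, Hp, Bool.andb_true_r in Hk2.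
rewrite <- Z.negb_even in Hk2. apply Bool.negb_false_iff, Z.even_spec in Hk2.
destruct Hk2 as [h ->]. exists h; lia.
Qed.

(** Pigeonhole in a box with sides sqrt(2pw), sqrt(w), sqrt(2p) gives x, y, u, not
    all zero, with x = by mod w and x^2 + 2p y^2 - w u^2 divisible by 2pw.  The size of
    the box leaves only the values 0 and 2pw.  The norm form F of the ideal then has
    F = u^2 or F = u^2 + 2p; in the second case multiplying the element by
    u + sqrt(-2p), of norm u^2 + 2p, makes the value a square. *)
Lemma legendre p w b c r : prime p -> Z.odd p = true -> 0 < w -> Z.odd w = true ->
  ~ (p | w) -> w * c = b * b + 2 * p -> (p | r * r - w) ->
  exists k y v, v <> 0 /\ w * (k * k) + 2 * b * (k * y) + c * (y * y) = v * v.
Proof.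
intros Hp Hpo Hw Hwo Hpw Hc Hr.
assert (Hp2 : 2 <= p) by (destruct Hp; lia).
destruct (odd_sqrt_mod_2p p w r Hpo Hwo Hr) as (s & [h Hs]).
destruct (floor_sqrt (2 * p * w)) as (X & HX0 & HX1 & HX); [nia|].
destruct (floor_sqrt w) as (Y & HY0 & HY1 & HY); [lia|].
destruct (floor_sqrt (2 * p)) as (U & HU0 & HU1 & HU); [lia|].
assert (Hbig := legendre_box_count w p X Y U Hw ltac:(lia) HX0 HY0 HU0 HX HY HU).
destruct (pigeonhole
  (fun q : Z * (Z * Z) => ((fst q - b * fst (snd q)) mod w, (fst q - s * snd (snd q)) mod (2 * p)))
  (list_prod (below (X + 1)) (list_prod (below (Y + 1)) (below (U + 1))))
  (list_prod (below w) (below (2 * p))))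
  as ([x1 [y1 u1]] & [x2 [y2 u2]] & H1 & H2 & Hne & E).
{ repeat apply NoDup_pairs; apply NoDup_below. }
{ intros q _; apply in_prod; apply in_below, Z.mod_pos_bound; lia. }
{ rewrite !length_prod. apply Nat2Z.inj_lt. rewrite !Nat2Z.inj_mul, !length_below; lia. }
rewrite !in_prod_iff, !in_below in H1, H2.
apply pair_equal_spec in E; cbn [fst snd] in E; destruct E as [E1 E2].
apply mod_eq_divide in E1, E2; try lia.
assert (Hx : Z.abs (x1 - x2) <= X) by lia.
assert (Hy : Z.abs (y1 - y2) <= Y) by lia.
assert (Hu : Z.abs (u1 - u2) <= U) by lia.
assert (Hnz : x1 - x2 <> 0 \/ y1 - y2 <> 0 \/ u1 - u2 <> 0).
{ destruct (Z.eq_dec x1 x2), (Z.eq_dec y1 y2), (Z.eq_dec u1 u2); try lia. subst; congruence. }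
replace (x1 - b * y1 - (x2 - b * y2)) with (x1 - x2 - b * (y1 - y2)) in E1 by ring.
replace (x1 - s * u1 - (x2 - s * u2)) with (x1 - x2 - s * (u1 - u2)) in E2 by ring.
set (x := x1 - x2) in *; set (y := y1 - y2) in *; set (u := u1 - u2) in *.
clearbody x y u. clear H1 H2 Hne x1 x2 y1 y2 u1 u2 HX HY HU Hbig.
destruct E1 as [k Hk], E2 as [l Hl].
set (F := w * (k * k) + 2 * b * (k * y) + c * (y * y)).
assert (HF : w * F = x * x + 2 * p * (y * y)).
{ replace x with (b * y + k * w) by lia. replace (2 * p) with (w * c - b * b) by lia.
  unfold F; ring. }
assert (Hm : (2 * p | F - u * u)).
{ apply Z.gauss with w.
  - exists (l * (x + s * u) + h * (u * u) + y * y).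
    replace (w * (F - u * u)) with (w * F - w * (u * u)) by ring. rewrite HF.
    replace (x * x) with ((x - s * u) * (x + s * u) + s * s * (u * u)) by ring.
    rewrite Hl. replace (s * s) with (h * (2 * p) + w) by lia. ring.
  - apply Zgcd_1_rel_prime. apply rel_prime_sym, rel_prime_mult; apply rel_prime_sym, prime_rel_prime.
    + apply prime_2.
    + intros [q ->]. rewrite Z.odd_mul, Bool.andb_false_r in Hwo; discriminate.
    + exact Hp.
    + exact Hpw. }
destruct Hm as [m Hm].
assert (Hxx : x * x <= 2 * p * w) by (clear - Hx HX1; nia).
assert (Hyy : y * y <= w) by (clear - Hy HY1; nia).
assert (Huu : u * u <= 2 * p) by (clear - Hu HU1; nia).
apply Z.odd_spec in Hpo, Hwo. destruct Hpo as [hp Hhp], Hwo as [hw Hhw].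
(* The inequalities are strict since 2p and 2pw are 2 modulo 4. *)
assert (Huu' : u * u < 2 * p).
{ enough (u * u <> 2 * p) by lia. intro E.
  destruct (Z.Even_or_Odd u) as [[u' Hu']|[u' Hu']]; subst u p; lia. }
assert (Hxx' : x * x < 2 * p * w).
{ enough (x * x <> 2 * p * w) by lia. intro E.
  destruct (Z.Even_or_Odd x) as [[x' Hx']|[x' Hx']]; subst x p w; lia. }
assert (HFm : w * (2 * p) * m = x * x + 2 * p * (y * y) - w * (u * u)).
{ rewrite <- HF. transitivity (w * (F - u * u)); [rewrite Hm|]; ring. }
assert (B1 : 2 * p * (y * y) <= 2 * p * w) by (apply Z.mul_le_mono_nonneg_l; lia).
assert (B2 : w * (u * u) < w * (2 * p)) by (apply Z.mul_lt_mono_pos_l; lia).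
assert (B3 : 0 <= w * (u * u)) by (apply Z.mul_nonneg_nonneg; [lia|apply Z.square_nonneg]).
assert (B4 : 0 <= 2 * p * (y * y)) by (apply Z.mul_nonneg_nonneg; [lia|apply Z.square_nonneg]).
pose proof (Z.square_nonneg x).
assert (Hpos : 0 < w * (2 * p)) by (apply Z.mul_pos_pos; lia).
assert (Hm01 : m = 0 \/ m = 1).
{ assert (-1 < m < 2); [|lia].
  split; apply (Z.mul_lt_mono_pos_l (w * (2 * p))); lia. }
destruct Hm01 as [-> | ->].
- exists k, y, u. split; [|fold F; lia].
  intros ->. assert (x * x = 0) by lia. assert (2 * p * (y * y) = 0) by lia.
  clear - H0 H1 Hnz Hp2. destruct Hnz as [|[|]]; nia.
- exists (k * u - b * k - c * y), (b * y + w * k + u * y), (u * u + 2 * p).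
  split; [pose proof (Z.square_nonneg u); lia|].
  replace (u * u + 2 * p) with F at 1 by lia.
  replace (u * u + 2 * p) with (u * u + (w * c - b * b)) by lia.
  unfold F; ring.
Qed.

Lemma square_unit_ideal D : same_class D (square D (ideal 1 0)) (ideal 1 0).
Proof.
apply same_class_ext. intro z. rewrite square_ideal; [reflexivity| |].
- apply rel_prime_1.
- apply Z.divide_1_l.
Qed.

(** 2 ramifies: (2, theta)^2 = (4, 2 theta, -2p) = (2) as p is odd. *)
Lemma square_ideal_2 p : Z.odd p = true ->
  same_class (2 * p) (square (2 * p) (ideal 2 0)) (ideal 1 0).
Proof.
intro Hp; apply Z.odd_spec in Hp; destruct Hp as [h ->].
exists (1, 0), (2, 0).
split; [|split; [|split]]; try (unfold qnorm, fst, snd; lia).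
- intros z Hz.
  assert (E : exists j, z = qmul (2 * (2 * h + 1)) (2, 0) j).
  { induction Hz as [[x y] [x' y'] [k Hk] [k' Hk'] | u v _ [j Ej] _ [j' Ej']].
    - unfold fst, snd in Hk, Hk'.
      exists (2 * k * k' - (2 * h + 1) * (y * y'), k * y' + y * k').
      unfold qmul, fst, snd; f_equal; [|lia].
      replace x with (k * 2) by lia. replace x' with (k' * 2) by lia. ring.
    - exists (qadd j j'). rewrite qmulDr. congruence. }
  destruct E as [j ->]. exists j; split; [exists (fst j - 0 * snd j); ring|].
  destruct j as [x y]; unfold qmul, fst, snd; f_equal; ring.
- intros [x y] _. exists (2 * x, 2 * y); split.
  + replace (2 * x, 2 * y) with
     (qadd (qmul (2 * (2 * h + 1)) (2, 0) ((2 * h + 2) * x, (2 * h + 2) * y))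
       (qmul (2 * (2 * h + 1)) (0, 1) (- (2 * (2 * h + 1)) * y, x))).
    * apply square_add; apply square_mul; unfold ideal, fst, snd.
      -- exists 1; ring.
      -- exists ((h + 1) * x); ring.
      -- exists 0; ring.
      -- exists (- (2 * h + 1) * y); ring.
    * unfold qadd, qmul, fst, snd; f_equal; ring.
  + unfold qmul, fst, snd; f_equal; ring.
Qed.

(** A generator would have a norm dividing both 4 and 2p, and of the form
    4k^2 + 2p y^2, which is impossible. *)
Lemma ideal_2_not_principal p : 2 < p -> Z.odd p = true ->
  ~ same_class (2 * p) (ideal 2 0) (ideal 1 0).
Proof.
intros Hp Hpo (a & b & Ha & Hb & F & G).
assert (one : ideal 1 0 (1, 0)) by apply Z.divide_1_l.
destruct (G _ one) as (i & Hi & Ei).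
destruct (F (2, 0)) as (j & _ & Ej); [exists 1; reflexivity|].
destruct (F (0, 1)) as (j' & _ & Ej'); [exists 0; reflexivity|].
apply (f_equal (qnorm (2 * p))) in Ei, Ej, Ej'. rewrite !qnorm_mul in Ei, Ej, Ej'.
destruct i as [x y]. unfold ideal, fst, snd in Hi. destruct Hi as [k Hk].
assert (N1 : qnorm (2 * p) (1, 0) = 1) by (unfold qnorm, fst, snd; lia).
assert (N2 : qnorm (2 * p) (2, 0) = 4) by (unfold qnorm, fst, snd; lia).
assert (N3 : qnorm (2 * p) (0, 1) = 2 * p) by (unfold qnorm, fst, snd; lia).
rewrite N1, Z.mul_1_r in Ei. rewrite N2 in Ej. rewrite N3 in Ej'.
rewrite <- Ei in Ej, Ej'.
assert (D4 : 4 = qnorm (2 * p) (x, y) * qnorm (2 * p) j).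
{ apply Z.mul_cancel_l with (qnorm (2 * p) a); [assumption|]. lia. }
assert (D2p : 2 * p = qnorm (2 * p) (x, y) * qnorm (2 * p) j').
{ apply Z.mul_cancel_l with (qnorm (2 * p) a); [assumption|]. lia. }
assert (Nn : 0 <= qnorm (2 * p) (x, y)).
{ unfold qnorm, fst, snd. pose proof (Z.square_nonneg x). pose proof (Z.square_nonneg y). nia. }
set (N := qnorm (2 * p) (x, y)) in *.
assert (EN : N = x * x + 2 * p * (y * y)) by reflexivity.
clearbody N.
assert (N <= 4) by (apply Z.divide_pos_le; [lia | exists (qnorm (2 * p) j); lia]).
assert (Hx : x = 2 * k) by lia. subst x.
assert (y * y = 0) by (pose proof (Z.square_nonneg y); nia).
apply Z.odd_spec in Hpo; destruct Hpo as [h ->].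
assert (N = 4 * (k * k)) by lia. assert (k * k = 1 \/ k * k = 0) by nia.
assert (N = 0 \/ N = 4) as [-> | ->]; lia.
Qed.

(** The ideals whose class has a square root: the prime above 2, where the chain
    starts, and those to which [legendre] applies.  The square roots found are again of
    the second kind. *)
Definition admissible (p w b : Z) : Prop :=
  0 < w /\ (w | b * b + 2 * p) /\ (w = 2 /\ b = 0 \/ Z.odd w = true /\ ~ (p | w)).

(** x^2 - 2y^2 is a small multiple of p by Thue's lemma; the unit 1 + sqrt(2) of norm
    -1 corrects the sign.  It says that the norm form of the prime above 2 represents a
    square. *)
Lemma residue_2_pell p : prime p -> residue p 2 -> Z.odd p = true ->
  exists x v, v <> 0 /\ 2 * (x * x) + p = v * v.
Proof.
intros Hp H2 Hpo.
assert (Hp2 : 2 <= p) by (destruct Hp; lia).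
destruct (thue_form p (-2) 1) as (x & y & m & Hxy & E & Hx & Hy); [lia|lia|exact H2|].
assert (Hm : m = 1 \/ m = 0 \/ m = -1 \/ m = -2) by nia.
apply Z.odd_spec in Hpo; destruct Hpo as [h Hh].
destruct Hm as [-> | [-> | [-> | ->]]].
- exists y, x. split; [|lia]. nia.
- exfalso. assert (D : (y | x)) by (apply square_divide; exists 2; lia).
  destruct D as [k ->]. assert (y <> 0) by (intros ->; lia).
  assert (k * k = 2).
  { apply Z.mul_cancel_r with (y * y); [nia|]. lia. }
  assert (k <= -2 \/ k = -1 \/ k = 0 \/ k = 1 \/ 2 <= k) as [|[|[|[|]]]] by lia; nia.
(* multiplication of x + y sqrt(2) by 1 + sqrt(2) *)
- exists (x + y), (x + 2 * y). split; [|lia]. nia.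
- destruct (Z.Even_or_Odd x) as [[x' ->]|[x' ->]]; [|lia].
  exists x', y; split; [nia|lia].
Qed.

Lemma class_square_root p w b : prime p -> Z.odd p = true -> residue p 2 ->
  (forall A B, 0 < A -> (A | B * B + 2 * p) -> residue p A) ->
  admissible p w b ->
  exists w' b', admissible p w' b' /\ same_class (2 * p) (square (2 * p) (ideal w' b')) (ideal w b).
Proof.
intros Hp Hpo H2 Hres (Hw & [c Hc] & Hcase).
assert (E : exists k y v, v <> 0 /\ w * (k * k) + 2 * b * (k * y) + c * (y * y) = v * v).
{ destruct Hcase as [[-> ->] | [Hwo Hpw]].
  - destruct (residue_2_pell p Hp H2 Hpo) as (x & v & Hv & E).
    exists x, 1, v; split; [exact Hv|]. lia.
  - destruct (Hres w b) as [r Hr]; try assumption; [exists c; lia|].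
    apply (legendre p w b c r); try assumption. lia. }
destruct E as (k & y & v & Hv & E).
destruct (ideal_square_root p w c b k y v) as (w' & b' & H1 & H3 & H4 & H5 & S); try assumption; try lia.
exists w', b'; split; [|exact S]. split; [exact H1|split; [exact H5|right; split; assumption]].
Qed.

(** Chains of each finite length suffice for a pigeonhole argument, and need no choice
    principle. *)
Lemma backward_chain {T : Type} (P : T -> Prop) (R : T -> T -> Prop) q0 :
  P q0 -> (forall q, P q -> exists q', P q' /\ R q' q) ->
  forall n : nat, exists J : nat -> T, J 0%nat = q0 /\
    (forall k, (k <= n)%nat -> P (J k)) /\
    (forall k, (k < n)%nat -> R (J (S k)) (J k)).
Proof.
intros H0 H n; induction n as [|n (J & E0 & E1 & E2)].
- exists (fun _ => q0); repeat split; auto; intros; lia.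
- destruct (H (J n)) as (q & Hq & Rq); [apply E1; lia|].
  exists (fun k => if Nat.leb k n then J k else q). split; [exact E0|split].
  + intros k Hk. destruct (Nat.leb_spec k n); [apply E1; lia|assumption].
  + intros k Hk. destruct (Nat.leb_spec (S k) n), (Nat.leb_spec k n); try lia.
    * apply E2; lia.
    * replace k with n by lia; exact Rq.
Qed.

(** Let J_0 be the prime above 2 and J_(k+1)^2 ~ J_k.  If J_m ~ J_n with m < n,
    squaring gives J_0 ~ J_(n-m), then J_(n-m-1) ~ J_(n-m)^2 ~ J_0^2 ~ 1, and squaring
    again J_0 ~ 1, which is false. *)
Lemma exists_nonresidue_divisor p : prime p -> Z.odd p = true -> residue p 2 ->
  exists A B, 0 < A /\ ~ residue p A /\ (A | B * B + 2 * p).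
Proof.
intros Hp Hpo H2.
assert (Hp3 : 2 < p).
{ destruct Hp. destruct (Z.eq_dec p 2); [subst; discriminate|lia]. }
apply NNPP; intro N.
assert (Hres : forall A B, 0 < A -> (A | B * B + 2 * p) -> residue p A).
{ intros A B HA D. apply NNPP; intro N'. apply N; exists A, B; auto. }
set (D := 2 * p).
set (bound := length (list_prod (below (2 * D + 1)) (below (2 * D + 1)))).
set (I := fun q : Z * Z => ideal (fst q) (snd q)).
destruct (backward_chain (fun q => admissible p (fst q) (snd q))
  (fun q' q => same_class D (square D (I q')) (I q)) (2, 0)) with (n := bound)
  as (J & J0 & Jadm & Jsq).
{ unfold fst, snd; split; [lia|split; [exists p; lia|left; auto]]. }
{ intros [w b] Hq. destruct (class_square_root p w b) as (w' & b' & H & HS); try assumption.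
  exists (w', b'); split; assumption. }
assert (down : forall i m n, (m + i <= bound)%nat -> (n + i <= bound)%nat ->
  same_class D (I (J (m + i)%nat)) (I (J (n + i)%nat)) -> same_class D (I (J m)) (I (J n))).
{ induction i as [|i IH]; intros m n Hm Hn HS; [now rewrite !Nat.add_0_r in HS|].
  apply IH; [lia|lia|].
  apply (same_class_trans _ _ (square D (I (J (S (m + i)))))); [apply same_class_sym, Jsq; lia|].
  apply (same_class_trans _ _ (square D (I (J (S (n + i)))))); [|apply Jsq; lia].
  apply same_class_square. rewrite !Nat.add_succ_r in HS; exact HS. }
assert (unit_sq : forall K, same_class D K (ideal 1 0) -> same_class D (square D K) (ideal 1 0)).
{ intros K HS. exact (same_class_trans _ _ _ _ (same_class_square _ _ _ HS) (square_unit_ideal D)). }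
assert (down1 : forall i, (i <= bound)%nat -> same_class D (I (J i)) (ideal 1 0) -> False).
{ induction i as [|i IH]; intros Hi HS.
  - apply (ideal_2_not_principal p Hp3 Hpo). rewrite J0 in HS; exact HS.
  - apply IH; [lia|].
    apply (same_class_trans _ _ (square D (I (J (S i))))); [apply same_class_sym, Jsq; lia|].
    now apply unit_sq. }
assert (no_repeat : forall m n, (m < n <= bound)%nat -> same_class D (I (J m)) (I (J n)) -> False).
{ intros m n Hmn HS.
  assert (S0 : same_class D (I (J 0%nat)) (I (J (n - m)%nat))).
  { apply (down m); try lia. replace (n - m + m)%nat with n by lia. exact HS. }
  destruct (n - m)%nat as [|d] eqn:Ed; [lia|].
  apply (down1 d); [lia|].
  apply (same_class_trans _ _ (square D (I (J (S d))))); [apply same_class_sym, Jsq; lia|].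
  apply (same_class_trans _ _ (square D (I (J 0%nat)))); [apply same_class_square, same_class_sym, S0|].
  rewrite J0. exact (square_ideal_2 p Hpo). }
destruct (pigeonhole_rel
  (fun k q => same_class D (I (J k)) (ideal (fst q) (snd q - D))) (seq 0 (S bound)) (seq_NoDup _ _)
  (list_prod (below (2 * D + 1)) (below (2 * D + 1)))) as (m & n & q & Hm & Hn & Hne & Sm & Sn).
- intros k Hk; apply in_seq in Hk.
  destruct (Jadm k) as (Hw & Hd & _); [lia|].
  destruct (same_class_ideal_reduced D) with (w := fst (J k)) (b := snd (J k))
    as (w0 & b0 & Hw0 & Hb0 & HS); [unfold D; lia|lia|exact Hd|].
  exists (w0, b0 + D); split; [apply in_prod; apply in_below; lia|].
  cbn [fst snd]. replace (b0 + D - D) with b0 by ring. exact HS.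
- rewrite length_seq. fold bound. lia.
- apply in_seq in Hm, Hn.
  assert (HS := same_class_trans _ _ _ _ Sm (same_class_sym _ _ _ Sn)).
  destruct (Nat.lt_trichotomy m n) as [H|[H|H]]; [|contradiction|].
  + apply (no_repeat m n); [lia|exact HS].
  + apply (no_repeat n m); [lia|now apply same_class_sym].
Qed.


(** * Primes *)

Definition represented (n : Z) : Prop :=
  exists t x y z, n = t*t + 2*(x*x) + 5*(y*y) + 10*(z*z).

(** The norm of a product of quaternions. *)
Lemma represented_mul m n : represented m -> represented n -> represented (m * n).
Proof.
intros (t & x & y & z & ->) (t' & x' & y' & z' & ->).
exists (t*t' - 2*x*x' - 5*y*y' - 10*z*z'), (t*x' + x*t' + 5*y*z' - 5*z*y'),
  (t*y' + y*t' + 2*z*x' - 2*x*z'), (t*z' + z*t' + x*y' - y*x').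
ring.
Qed.

Lemma mod3_squares x y : (3 | x*x + y*y) -> exists x' y', x = 3*x' /\ y = 3*y'.
Proof.
intros [k Hk].
assert (Hx : exists q, x = 3*q \/ x = 3*q+1 \/ x = 3*q-1).
{ exists ((x+1)/3). pose proof (Z.div_mod (x+1) 3); pose proof (Z.mod_pos_bound (x+1) 3). lia. }
assert (Hy : exists q, y = 3*q \/ y = 3*q+1 \/ y = 3*q-1).
{ exists ((y+1)/3). pose proof (Z.div_mod (y+1) 3); pose proof (Z.mod_pos_bound (y+1) 3). lia. }
destruct Hx as (q & Hx), Hy as (r & Hy). exists q, r.
destruct Hx as [->|[->| ->]], Hy as [->|[->| ->]]; try (split; reflexivity); lia.
Qed.

Lemma mod5_cases x : exists q, x = 5*q \/ x = 5*q+1 \/ x = 5*q-1 \/ x = 5*q+2 \/ x = 5*q-2.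
Proof.
exists ((x+2)/5). pose proof (Z.div_mod (x+2) 5); pose proof (Z.mod_pos_bound (x+2) 5). lia.
Qed.

Lemma residue_m2_represented p : prime p -> Z.odd p = true -> residue p (-2) -> represented p.
Proof.
intros Hp Hpo H. assert (Hp2 : 2 <= p) by (destruct Hp; lia).
destruct (thue_form p 2 1) as (x & y & m & Hxy & E & Hx & Hy); [lia|lia|exact H|].
assert (Hm : m = 1 \/ m = 2 \/ m = 3) by nia.
apply Z.odd_spec in Hpo; destruct Hpo as [h Hh].
destruct Hm as [-> | [-> | ->]].
- exists x, y, 0, 0; lia.
- destruct (Z.Even_or_Odd x) as [[x' ->]|[x' ->]]; [|lia].
  exists y, x', 0, 0; lia.
- exfalso. assert (x * x = p) by lia.
  assert (D : (p | x)) by (assert (D : (p | x * x)) by (exists 1; lia); apply prime_mult in D; tauto).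
  destruct D as [k ->]. assert (k * k * p = 1) by (apply Z.mul_cancel_r with p; lia).
  assert (k = 0 \/ 1 <= k * k) as [-> |] by nia; nia.
Qed.

Lemma residue_m10_represented p : prime p -> Z.odd p = true -> p <> 3 ->
  residue p (-10) -> represented p.
Proof.
intros Hp Hpo Hp3 H. assert (Hp2 : 2 <= p) by (destruct Hp; lia).
(* Stretching by 3 keeps m below 7: the forms of determinant 10 make m = 7
   possible. *)
destruct (thue_form p 10 3) as (x & y & m & Hxy & E & Hx & Hy); [lia|lia|exact H|].
assert (Hm : m = 1 \/ m = 2 \/ m = 3 \/ m = 4 \/ m = 5 \/ m = 6) by nia.
apply Z.odd_spec in Hpo; destruct Hpo as [h Hh].
assert (no3 : (3 | m) -> m < 7 -> False).
{ intros [q ->] Hq. destruct (mod3_squares x y) as (x' & y' & -> & ->); [exists (q*p - 3*(y*y)); lia|].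
  assert (D : (3 | q * p)) by (exists (x'*x' + 10*(y'*y')); lia).
  apply prime_mult in D; [|exact prime_3]. destruct D as [D|D]; [destruct D; lia|].
  apply prime_div_prime in D; [lia|exact prime_3|exact Hp]. }
destruct Hm as [-> | [-> | [-> | [-> | [-> | ->]]]]].
- exists x, 0, 0, y; lia.
- destruct (Z.Even_or_Odd x) as [[x' ->]|[x' ->]]; [|lia]. exists 0, x', y, 0; lia.
- exfalso; apply no3; [exists 1|]; lia.
- destruct (Z.Even_or_Odd x) as [[x' ->]|[x' ->]]; [|lia].
  destruct (Z.Even_or_Odd y) as [[y' ->]|[y' ->]]; [|lia]. exists x', 0, 0, y'; lia.
- destruct (mod5_cases x) as (x' & [->|[->|[->|[->| ->]]]]); try lia. exists 0, y, x', 0; lia.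
- exfalso; apply no3; [exists 2|]; lia.
Qed.

Lemma residue_m1_mod4 p : prime p -> Z.odd p = true -> residue p (-1) ->
  exists h, p = 4 * h + 1.
Proof.
intros Hp Hpo H. assert (Hp2 : 2 <= p) by (destruct Hp; lia).
destruct (thue_form p 1 1) as (x & y & m & Hxy & E & Hx & Hy); [lia|lia|exact H|].
assert (Hm : m = 1 \/ m = 2) by nia.
apply Z.odd_spec in Hpo; destruct Hpo as [h Hh].
destruct (Z.Even_or_Odd h) as [[k ->]|[k ->]]; [exists k; lia|exfalso].
destruct (Z.Even_or_Odd x) as [[x' ->]|[x' ->]], (Z.Even_or_Odd y) as [[y' ->]|[y' ->]];
destruct Hm as [-> | ->]; try lia.
Qed.

Lemma residue_m5_represented p : prime p -> Z.odd p = true ->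
  residue p (-1) -> residue p (-5) -> represented p.
Proof.
intros Hp Hpo H1 H. assert (Hp2 : 2 <= p) by (destruct Hp; lia).
destruct (residue_m1_mod4 p Hp Hpo H1) as [h Hh].
destruct (thue_form p 5 2) as (x & y & m & Hxy & E & Hx & Hy); [lia|lia|exact H|].
assert (Hm : m = 1 \/ m = 2 \/ m = 3 \/ m = 4) by nia.
assert (odd_sq : forall k, exists j, (2*k+1)*(2*k+1) = 8*j+1).
{ intro k. destruct (Z.Even_or_Odd k) as [[q ->]|[q ->]];
  [exists (2*(q*q)+q) | exists (2*(q*q)+3*q+1)]; ring. }
destruct (Z.Even_or_Odd x) as [[x' Ex]|[x' Ex]], (Z.Even_or_Odd y) as [[y' Ey]|[y' Ey]];
 destruct Hm as [-> | [-> | [-> | ->]]]; try (exists x, 0, y, 0; lia).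
all: try (exfalso; subst x y; lia).
all: try (exists x', 0, y', 0; subst x y; lia).
all: exfalso; destruct (odd_sq x') as [i Ei], (odd_sq y') as [j Ej]; subst x y; lia.
Qed.

Lemma prime_5 : prime 5.
Proof.
apply prime_intro; [lia|]. intros n Hn. apply Zgcd_1_rel_prime.
assert (n = 1 \/ n = 2 \/ n = 3 \/ n = 4) as [-> | [-> | [-> | ->]]] by lia; reflexivity.
Qed.

(** Thue's lemma gives x^2 - 5y^2 = mp with -5 <= m <= 1; the cases m = -2 and m = -3
    are impossible modulo 4 and 3, and m = 0 since 5 is not a square. *)
Lemma residue_5_reciprocity p : prime p -> Z.odd p = true -> p <> 3 -> p <> 5 -> residue p 5 ->
  exists q, p = 5 * q + 1 \/ p = 5 * q - 1.
Proof.
intros Hp Hpo Hp3 Hp5 H. assert (Hp2 : 2 <= p) by (destruct Hp; lia).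
destruct (thue_form p (-5) 1) as (x & y & m & Hxy & E & Hx & Hy); [lia|lia|exact H|].
destruct (mod5_cases p) as (q & Hq). exists q.
assert (Hq5 : p <> 5 * q).
{ intro E5. apply Hp5. symmetry. apply prime_div_prime; [exact prime_5|exact Hp|exists q; lia]. }
assert (Hm : m = 1 \/ m = 0 \/ m = -1 \/ m = -2 \/ m = -3 \/ m = -4 \/ m = -5) by nia.
apply Z.odd_spec in Hpo; destruct Hpo as [h Hh].
destruct Hm as [-> | [-> | [-> | [-> | [-> | [-> | ->]]]]]].
- destruct (mod5_cases x) as (x' & [->|[->|[->|[->| ->]]]]); lia.
- exfalso. assert (D : (y | x)) by (apply square_divide; exists 5; lia).
  destruct D as [k ->]. assert (y <> 0) by (intros ->; lia).
  assert (k * k = 5).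
  { apply Z.mul_cancel_r with (y * y); [nia|]. lia. }
  assert (k <= -3 \/ k = -2 \/ k = -1 \/ k = 0 \/ k = 1 \/ k = 2 \/ 3 <= k) as [|[|[|[|[|[|]]]]]] by lia; nia.
- destruct (mod5_cases x) as (x' & [->|[->|[->|[->| ->]]]]); lia.
- exfalso. destruct (Z.Even_or_Odd x) as [[x' ->]|[x' ->]], (Z.Even_or_Odd y) as [[y' ->]|[y' ->]]; lia.
- exfalso. assert (D : (3 | x*x+y*y)) by (exists (2*(y*y) - p); lia).
  destruct (mod3_squares x y D) as (x' & y' & -> & ->).
  apply Hp3. symmetry. apply prime_div_prime; [exact prime_3|exact Hp|].
  exists (5*(y'*y') - x'*x'); lia.
- destruct (mod5_cases x) as (x' & [->|[->|[->|[->| ->]]]]); lia.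
- destruct (mod5_cases x) as (x' & [->|[->|[->|[->| ->]]]]); try lia.
  destruct (mod5_cases y) as (y' & [->|[->|[->|[->| ->]]]]); lia.
Qed.

Lemma inverse_mod p u : prime p -> ~ (p | u) -> exists w k, u * w = 1 + k * p.
Proof.
intros Hp Hu. assert (R : rel_prime u p) by (now apply rel_prime_sym, prime_rel_prime).
apply rel_prime_bezout in R; destruct R as [w k R]. exists w, (-k); lia.
Qed.

(** -2p is 2 or 3 modulo 5, hence not a square. *)
Lemma minus_2_mod_5 p u z : (exists q, p = 5 * q + 1 \/ p = 5 * q - 1) ->
  (5 | u * u + 2 * p * (z * z)) -> (5 | u) /\ (5 | z).
Proof.
intros (q & Hq) [k Hk].
destruct (mod5_cases u) as (u' & Hu), (mod5_cases z) as (z' & Hz).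
assert (E : exists k', u * u + 2 * (z * z) = 5 * k' \/ u * u - 2 * (z * z) = 5 * k').
{ destruct Hq as [-> | ->]; [exists (k - 2 * q * (z * z)) | exists (k - 2 * q * (z*z))]; lia. }
clear Hk Hq. destruct E as (k' & E).
destruct Hu as [->|[->|[->|[->| ->]]]], Hz as [->|[->|[->|[->| ->]]]]; try lia.
split; [exists u'|exists z']; ring.
Qed.

Lemma mod_5_square p m x k : (exists q, p = 5 * q + 1 \/ p = 5 * q - 1) ->
  p * m = x * x + 5 * k -> m mod 5 = 0 \/ m mod 5 = 1 \/ m mod 5 = 4.
Proof.
intros (q & Hq) E.
assert (H : exists k', m = 5 * k' + x * x \/ m = 5 * k' - x * x).
{ destruct Hq as [-> | ->]; [exists (k - q * m) | exists (q * m - k)]; lia. }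
destruct H as (k' & H). pose proof (Z.div_mod m 5). pose proof (Z.mod_pos_bound m 5).
destruct (mod5_cases x) as (x' & [->|[->|[->|[->| ->]]]]); lia.
Qed.

(** The lattice is x = pX + ry + tz.  Modulo p the form Ay^2 + 2Byz + Cz^2 is A times
    the square of y + (B/A) z, as its determinant 2p vanishes; so it is enough that
    5r^2 = -A and t = r (B/A), i.e. 5rt = -B. *)
Lemma hard_prime_represented p : prime p -> Z.odd p = true ->
  (exists q, p = 5 * q + 1 \/ p = 5 * q - 1) ->
  residue p 5 -> residue p 2 -> ~ residue p (-1) -> represented p.
Proof.
intros Hp Hpo Hp5 H5 H2 H1. assert (Hp2 : 2 <= p) by (destruct Hp; lia).
destruct (exists_nonresidue_divisor p Hp Hpo H2) as (A & B & HA & NA & [C HC]).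
destruct (nonresidue_mul p A (-1) Hp Hpo NA) as [H|[e [e' He]]]; [contradiction|].
destruct H5 as [g [g' Hg]].
assert (Hp5' : ~ (p | 5)).
{ intro D. apply prime_div_prime in D; [|exact Hp|exact prime_5].
  destruct Hp5 as (q & ?); lia. }
assert (Ng : ~ (p | g)).
{ intros [k ->]. apply Hp5'. exists (k * k * p - g'); lia. }
destruct (inverse_mod p g Hp Ng) as (w & k & Hw).
(* e^2 = -A, g^2 = 5 and w = 1/g modulo p *)
set (r := e * w).
assert (Hr : exists b, 5 * (r * r) + A = b * p).
{ exists (- g' * (r * r) + e * e * k * (2 + k * p) + e').
  unfold r. replace 5 with (g * g - g' * p) by lia.
  transitivity (e * e * ((g * w) * (g * w)) - g' * p * (e * w * (e * w)) + A); [ring|].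
  rewrite Hw. replace A with (e' * p - e * e) by lia. ring. }
destruct Hr as [b Hb].
(* 0 counts as a residue, so p does not divide A. *)
assert (NA0 : ~ (p | A)).
{ intros [q ->]. apply NA. exists 0, (-q). ring. }
assert (N5r : ~ (p | 5 * r)).
{ intros [q Hq]. apply NA0. exists (b - q * r).
  replace A with (b * p - 5 * r * r) by lia. rewrite Hq. ring. }
destruct (inverse_mod p (5 * r) Hp N5r) as (w' & k' & Hw').
set (t := - B * w').
assert (Hd : 5 * (r * t) + B = - B * k' * p).
{ unfold t. transitivity (- B * (5 * r * w') + B); [ring|]. rewrite Hw'. ring. }
set (d := - B * k') in *. clearbody d t r.
assert (Hc : (p | 5 * (t * t) + C)).
{ assert (D : (p | (5 * r) * ((5 * r) * (5 * (t * t) + C)))).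
  { exists (5 * (d * (5 * (r * t) - B)) + 5 * C * b - 10).
    transitivity (5 * ((5 * (r * t)) * (5 * (r * t)) + C * (5 * (r * r)))); [ring|].
    replace (5 * (r * r)) with (b * p - A) by lia.
    replace (5 * (r * t)) with (d * p - B) by lia.
    transitivity (5 * ((d * p - B) * (d * p - B) + C * b * p - (B * B + 2 * p)));
      [rewrite HC; ring|]. ring. }
  apply prime_mult in D; [|exact Hp]. destruct D as [D|D]; [contradiction|].
  apply prime_mult in D; [|exact Hp]. tauto. }
destruct Hc as [c Hc].
set (V := fun n => exists x y z, ternary (5 * p) b c d (5 * t) (5 * r) x y z = n).
assert (HV : forall x y z n, ternary (5 * p) b c d (5 * t) (5 * r) x y z = n ->
   p * n = 5 * ((p * x + r * y + t * z) * (p * x + r * y + t * z))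
           + (A * (y * y) + 2 * B * (y * z) + C * (z * z))).
{ intros x y z n <-. unfold ternary.
  replace A with (b * p - 5 * (r * r)) by lia.
  replace B with (d * p - 5 * (r * t)) by lia.
  replace C with (c * p - 5 * (t * t)) by lia. ring. }
assert (V5p : V (5 * p)).
{ exists 1, 0, 0. unfold ternary. ring. }
assert (R : exists x y z, 5 * p = x*x + 2*(y*y) + 5*(z*z)).
{ apply (ternary_det_10 V) with (a := 5 * p) (M := 5 * A) (b := b) (c := c) (d := d) (e := 5 * t) (f := 5 * r);
    try lia; [| | |intro n; reflexivity|exact V5p].
  - exists (5 * p); split; [exact V5p|]. rewrite Z.odd_mul, Hpo; reflexivity.
  - intros m (x & y & z & E). apply HV in E.
    set (X := p * x + r * y + t * z) in *. clearbody X.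
    set (F := A * (y * y) + 2 * B * (y * z) + C * (z * z)) in *.
    assert (EF : A * F = (A * y + B * z) * (A * y + B * z) + 2 * p * (z * z)).
    { unfold F. transitivity ((A * y + B * z) * (A * y + B * z) + (C * A - B * B) * (z * z)); [ring|].
      rewrite <- HC. ring. }
    assert (DF : (5 | (A * y + B * z) * (A * y + B * z) + 2 * p * (z * z))).
    { rewrite <- EF. exists (A * (p * m - X * X)). replace F with (p * (5 * m) - 5 * (X * X)) by lia. ring. }
    apply minus_2_mod_5 in DF; [|exact Hp5]. destruct DF as [[u Hu] [z' ->]].
    assert (D5 : (5 | A * y)) by (exists (u - B * z'); lia).
    apply prime_mult in D5; [|exact prime_5]. destruct D5 as [[A' HA']|[y' ->]].
    { exfalso. destruct (minus_2_mod_5 p B 1 Hp5) as [_ [q Hq]]; [|lia].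
      exists (C * A'). rewrite !Z.mul_1_r, HC, HA'. ring. }
    apply (mod_5_square p m X (A * (y' * y') + 2 * B * (y' * z') + C * (z' * z')) Hp5).
    unfold F in E. lia.
  - unfold ternary_det. apply Z.mul_cancel_r with (p); [lia|].
    transitivity (5 * ((b * p) * (c * p)) + 50 * (d * p) * (r * t) - 5 * ((d * p) * (d * p))
      - 25 * (t * t) * (b * p) - 25 * (r * r) * (c * p)); [ring|].
    rewrite <- Hb, <- Hc, <- Hd. transitivity (5 * (C * A - B * B)); [ring|]. rewrite <- HC; ring. }
destruct R as (x & y & z & E).
destruct (mod5_cases x) as (x' & Hx), (mod5_cases y) as (y' & Hy).
destruct Hx as [->|[->|[->|[->| ->]]]], Hy as [->|[->|[->|[->| ->]]]]; try lia.
exists z, 0, x', y'. lia.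
Qed.

Lemma residue_div_4 p a : Z.odd p = true -> residue p (4 * a) -> residue p a.
Proof.
intros Hp [g [k Hk]]. apply Z.odd_spec in Hp; destruct Hp as [h Hh].
assert (G : Z.gcd p 4 = 1).
{ apply Zgcd_1_rel_prime, bezout_rel_prime.
  apply Bezout_intro with p (- (h * h + h)). subst p; ring. }
destruct (Z.Even_or_Odd g) as [[g' Hg]|[g' Hg]].
- exists g'. apply Z.gauss with 4; [exists k; subst g; lia|exact G].
- exists (g' + h + 1). apply Z.gauss with 4; [exists (k + 2 * g + p); subst g p; lia|exact G].
Qed.

(** If -2 and -10 are not squares, their product 20 is, and so is 5.  If -1
    is a square, then so is -5; otherwise (-1)(-2) = 2 is. *)
Lemma prime_represented p : prime p -> represented p.
Proof.
intro Hp.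
destruct (Z.odd p) eqn:Hpo.
2: { assert (D : (2 | p)).
  { rewrite <- Z.negb_even in Hpo. apply Bool.negb_false_iff, Z.even_spec in Hpo.
    destruct Hpo as [h ->]; exists h; ring. }
  apply prime_div_prime in D; [subst p|exact prime_2|exact Hp].
  now exists 0, 1, 0, 0. }
destruct (Z.eq_dec p 3) as [->|H3]; [now exists 1, 1, 0, 0|].
destruct (Z.eq_dec p 5) as [->|H5]; [now exists 0, 0, 1, 0|].
destruct (classic (residue p (-2))) as [R2|N2]; [now apply residue_m2_represented|].
destruct (classic (residue p (-10))) as [R10|N10]; [now apply residue_m10_represented|].
assert (R5 : residue p 5).
{ destruct (nonresidue_mul p (-2) (-10) Hp Hpo N2) as [R|[g [k Hk]]]; [contradiction|].
  apply residue_div_4; [exact Hpo|]. now exists g, k. }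
destruct (classic (residue p (-1))) as [R1|N1].
- apply residue_m5_represented; try assumption.
  destruct R1 as [e [e' He]], R5 as [g [g' Hg]].
  exists (e * g), (e' * (g * g) - g').
  transitivity ((e * e - -1) * (g * g) - (g * g - 5)); [ring|]. rewrite He, Hg; ring.
- assert (R2 : residue p 2).
  { destruct (nonresidue_mul p (-2) (-1) Hp Hpo N2) as [R|R]; [contradiction|exact R]. }
  apply hard_prime_represented; try assumption.
  now apply residue_5_reciprocity.
Qed.

Lemma positive_represented n : 1 <= n -> represented n.
Proof.
revert n; refine (Zlt_lower_bound_ind _ 1 _); intros n IH Hn.
destruct (Z.eq_dec n 1) as [->|Hn1]; [now exists 1, 0, 0, 0|].
destruct (prime_dec n) as [Hp|Np]; [now apply prime_represented|].
destruct (not_prime_divide n) as (d & Hd & [e ->]); [lia|exact Np|].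
apply represented_mul; apply IH; nia.
Qed.

Theorem theorem1 :
  universal (fun t x y z : Z => t ^ 2 + 2 * x ^ 2 + 5 * y ^ 2 + 10 * z ^ 2).
Proof.
intros n Hn.
destruct (positive_represented n) as (t & x & y & z & ->); [lia|].
exists t, x, y, z. rewrite !Z.pow_2_r. reflexivity.
Qed.
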